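(* For every superintuitionistic rule system $\mathtt{L}$, $\mathtt{L}$ is Kripke complete if and only if $\tau\mathtt{L}:=\mathtt{S4_R}\oplus\{T(\Gamma/\Delta):\Gamma/\Delta\in\mathtt{L}\}$ is Kripke complete.
   Context: A rule is a pair $\Gamma/\Delta$ of finite sets of formulae; rule systems are sets of rules closed under substitution, reflexivity ($\varphi/\varphi$), weakening on both sides and cut. A si rule system is a rule system in signature $\{\land,\lor,\to,\bot,\top\}$ containing $/\varphi$ for all $\varphi\in\mathtt{IPC}$ and $\varphi,\varphi\to\psi/\psi$. A normal modal rule system is one in signature $\{\land,\lor,\neg,\square,\bot,\top\}$ containing $/\varphi$ for all $\varphi\in\mathtt{K}$, $\varphi,\varphi\to\psi/\psi$, $\varphi/\square\varphi$; $\mathtt{S4_R}$ is the least one containing $/\varphi$ for all $\varphi\in\mathtt{S4}$, and $\oplus$ denotes the least normal modal rule system containing the given rules. Gödel translation: $T(p)=\square p$, $T(\bot)=\bot$, $T(\top)=\top$, $T$ commutes with $\land,\lor$, $T(\varphi\to\psi)=\square(\neg T\varphi\lor T\psi)$, $T(\Gamma/\Delta)=T[\Gamma]/T[\Delta]$. Si formulae are interpreted on Kripke frames that are partial orders with valuations into upsets (intuitionistic semantics); modal formulae on Kripke frames $(X,R)$ in the usual way. A rule $\Gamma/\Delta$ is valid on a frame if for every valuation, if every $\gamma\in\Gamma$ is true at all points then some $\delta\in\Delta$ is true at all points. A rule system (si or modal) is Kripke complete if it equals $\{\Gamma/\Delta:\mathcal{K}\models\Gamma/\Delta\}$ for some class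 $\mathcal{K}$ of Kripke frames. *)

(* Defs.v *)
From HB Require Import structures.
From Stdlib Require Import Relation_Definitions.
From mathcomp Require Import all_boot finmap.

Set Implicit Arguments.
Unset Strict Implicit.
Unset Printing Implicit Defensive.

Local Open Scope fset_scope.

Inductive siform : Type :=
| SVar of nat
| SBot
| STop
| SAnd of siform & siform
| SOr of siform & siform
| SImp of siform & siform.

Inductive mform : Type :=
| MVar of nat
| MBot
| MTop
| MNeg of mform
| MAnd of mform & mform
| MOr of mform & mform
| MBox of mform.

Definition MImp (a b : mform) : mform := MOr (MNeg a) b.

Fixpoint siform_enc (a : siform) : GenTree.tree nat :=
  match a with
  | SVar n => GenTree.Leaf n
  | SBot => GenTree.Node 0 [::]
  | STop => GenTree.Node 1 [::]
  | SAnd a b => GenTree.Node 2 [:: siform_enc a; siform_enc b]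
  | SOr a b => GenTree.Node 3 [:: siform_enc a; siform_enc b]
  | SImp a b => GenTree.Node 4 [:: siform_enc a; siform_enc b]
  end.

Fixpoint siform_dec (t : GenTree.tree nat) : siform :=
  match t with
  | GenTree.Leaf n => SVar n
  | GenTree.Node 1 [::] => STop
  | GenTree.Node 2 [:: t; u] => SAnd (siform_dec t) (siform_dec u)
  | GenTree.Node 3 [:: t; u] => SOr (siform_dec t) (siform_dec u)
  | GenTree.Node 4 [:: t; u] => SImp (siform_dec t) (siform_dec u)
  | _ => SBot
  end.

Lemma siform_encK : cancel siform_enc siform_dec.
Proof. by elim=> //= a -> b ->. Qed.

HB.instance Definition _ := Choice.copy siform (can_type siform_encK).

Fixpoint mform_enc (a : mform) : GenTree.tree nat :=
  match a with
  | MVar n => GenTree.Leaf n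
  | MBot => GenTree.Node 0 [::]
  | MTop => GenTree.Node 1 [::]
  | MNeg a => GenTree.Node 2 [:: mform_enc a]
  | MAnd a b => GenTree.Node 3 [:: mform_enc a; mform_enc b]
  | MOr a b => GenTree.Node 4 [:: mform_enc a; mform_enc b]
  | MBox a => GenTree.Node 5 [:: mform_enc a]
  end.

Fixpoint mform_dec (t : GenTree.tree nat) : mform :=
  match t with
  | GenTree.Leaf n => MVar n
  | GenTree.Node 1 [::] => MTop
  | GenTree.Node 2 [:: t] => MNeg (mform_dec t)
  | GenTree.Node 3 [:: t; u] => MAnd (mform_dec t) (mform_dec u)
  | GenTree.Node 4 [:: t; u] => MOr (mform_dec t) (mform_dec u)
  | GenTree.Node 5 [:: t] => MBox (mform_dec t)
  | _ => MBot
  end.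

Lemma mform_encK : cancel mform_enc mform_dec.
Proof. by elim=> //= [a ->|a -> b ->|a -> b ->|a ->]. Qed.

HB.instance Definition _ := Choice.copy mform (can_type mform_encK).

Fixpoint si_subst (s : nat -> siform) (a : siform) : siform :=
  match a with
  | SVar n => s n
  | SBot => SBot
  | STop => STop
  | SAnd a b => SAnd (si_subst s a) (si_subst s b)
  | SOr a b => SOr (si_subst s a) (si_subst s b)
  | SImp a b => SImp (si_subst s a) (si_subst s b)
  end.

Fixpoint m_subst (s : nat -> mform) (a : mform) : mform :=
  match a with
  | MVar n => s n
  | MBot => MBot
  | MTop => MTop
  | MNeg a => MNeg (m_subst s a)
  | MAnd a b => MAnd (m_subst s a) (m_subst s b)
  | MOr a b => MOr (m_subst s a) (m_subst s b)
  | MBox a => MBox (m_subst s a)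
  end.

Inductive IPC : siform -> Prop :=
| IPC_K a b : IPC (SImp a (SImp b a))
| IPC_S a b c :
    IPC (SImp (SImp a (SImp b c)) (SImp (SImp a b) (SImp a c)))
| IPC_andl a b : IPC (SImp (SAnd a b) a)
| IPC_andr a b : IPC (SImp (SAnd a b) b)
| IPC_and a b : IPC (SImp a (SImp b (SAnd a b)))
| IPC_orl a b : IPC (SImp a (SOr a b))
| IPC_orr a b : IPC (SImp b (SOr a b))
| IPC_or a b c :
    IPC (SImp (SImp a c) (SImp (SImp b c) (SImp (SOr a b) c)))
| IPC_bot a : IPC (SImp SBot a)
| IPC_top : IPC STop
| IPC_mp a b : IPC a -> IPC (SImp a b) -> IPC b.

(* Propositional evaluation: variables and boxed formulae are atoms. *)
Fixpoint prop_eval (v : mform -> bool) (a : mform) : bool :=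
  match a with
  | MBot => false
  | MTop => true
  | MNeg a => ~~ prop_eval v a
  | MAnd a b => prop_eval v a && prop_eval v b
  | MOr a b => prop_eval v a || prop_eval v b
  | MVar _ | MBox _ => v a
  end.

Definition tautology (a : mform) : Prop := forall v, prop_eval v a.

(* Closure under substitution is automatic when [Ax] is given by schemata. *)
Inductive normal_logic (Ax : mform -> Prop) : mform -> Prop :=
| NL_taut a : tautology a -> normal_logic Ax a
| NL_K a b :
    normal_logic Ax (MImp (MBox (MImp a b)) (MImp (MBox a) (MBox b)))
| NL_ax a : Ax a -> normal_logic Ax a
| NL_mp a b :
    normal_logic Ax a -> normal_logic Ax (MImp a b) -> normal_logic Ax b
| NL_nec a : normal_logic Ax a -> normal_logic Ax (MBox a).

Inductive S4_axiom : mform -> Prop :=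
| S4_T a : S4_axiom (MImp (MBox a) a)
| S4_4 a : S4_axiom (MImp (MBox a) (MBox (MBox a))).

Definition K : mform -> Prop := normal_logic (fun=> False).
Definition S4 : mform -> Prop := normal_logic S4_axiom.

(* The pair [(G, D)] is the rule G/D. *)
Definition rule (F : choiceType) : Type := ({fset F} * {fset F})%type.

Definition map_rule (F F' : choiceType) (f : F -> F') (r : rule F) : rule F' :=
  (f @` r.1, f @` r.2).

Definition axiom_rule (F : choiceType) (a : F) : rule F := (fset0, [fset a]).

Record rule_system (F : choiceType) (subst : (nat -> F) -> F -> F)
    (L : rule F -> Prop) : Prop := RuleSystem {
  rs_subst : forall (s : nat -> F) (r : rule F),
    L r -> L (map_rule (subst s) r);
  rs_refl : forall a : F, L ([fset a], [fset a]);
  rs_weak : forall G G' D D' : {fset F},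
    L (G, D) -> L (G `|` G', D `|` D');
  rs_cut : forall (G D : {fset F}) (a : F),
    L (G, a |` D) -> L (a |` G, D) -> L (G, D)
}.

Record si_rule_system (L : rule siform -> Prop) : Prop := SiRuleSystem {
  si_rs : rule_system si_subst L;
  si_IPC : forall a, IPC a -> L (axiom_rule a);
  si_mp : forall a b : siform, L ([fset a; SImp a b], [fset b])
}.

Record normal_modal_rule_system (M : rule mform -> Prop) : Prop :=
  NormalModalRuleSystem {
  nm_rs : rule_system m_subst M;
  nm_K : forall a, K a -> M (axiom_rule a);
  nm_mp : forall a b : mform, M ([fset a; MImp a b], [fset b]);
  nm_nec : forall a : mform, M ([fset a], [fset MBox a])
}.

Definition least_normal (P : rule mform -> Prop) (r : rule mform) : Prop :=
  forall M : rule mform -> Prop, normal_modal_rule_system M ->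
    (forall q, P q -> M q) -> M r.

Definition S4R : rule mform -> Prop :=
  least_normal (fun q => exists2 a, S4 a & q = axiom_rule a).

Definition oplus (M P : rule mform -> Prop) : rule mform -> Prop :=
  least_normal (fun q => M q \/ P q).

Fixpoint godel (a : siform) : mform :=
  match a with
  | SVar n => MBox (MVar n)
  | SBot => MBot
  | STop => MTop
  | SAnd a b => MAnd (godel a) (godel b)
  | SOr a b => MOr (godel a) (godel b)
  | SImp a b => MBox (MOr (MNeg (godel a)) (godel b))
  end.

Definition tau (L : rule siform -> Prop) : rule mform -> Prop :=
  oplus S4R (fun q => exists2 r, L r & q = map_rule godel r).

(* The carrier may be empty. The empty frame validates exactly the rules with
   a nonempty set of conclusions. *)
Record kframe : Type := KFrame {
  world :> Type;
  acc : relation world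
}.

Definition valuation (X : kframe) : Type := nat -> X -> Prop.

Definition persistent (X : kframe) (V : valuation X) : Prop :=
  forall n x y, acc x y -> V n x -> V n y.

Fixpoint si_sat (X : kframe) (V : valuation X) (x : X) (a : siform) : Prop :=
  match a with
  | SVar n => V n x
  | SBot => False
  | STop => True
  | SAnd a b => si_sat V x a /\ si_sat V x b
  | SOr a b => si_sat V x a \/ si_sat V x b
  | SImp a b => forall y, acc x y -> si_sat V y a -> si_sat V y b
  end.

Fixpoint m_sat (X : kframe) (V : valuation X) (x : X) (a : mform) : Prop :=
  match a with
  | MVar n => V n x
  | MBot => False
  | MTop => True
  | MNeg a => ~ m_sat V x a
  | MAnd a b => m_sat V x a /\ m_sat V x b
  | MOr a b => m_sat V x a \/ m_sat V x b
  | MBox a => forall y, acc x y -> m_sat V y a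
  end.

Definition si_valid (X : kframe) (r : rule siform) : Prop :=
  forall V : valuation X, persistent V ->
    (forall a, a \in r.1 -> forall x : X, si_sat V x a) ->
    exists2 b, b \in r.2 & forall x : X, si_sat V x b.

Definition m_valid (X : kframe) (r : rule mform) : Prop :=
  forall V : valuation X,
    (forall a, a \in r.1 -> forall x : X, m_sat V x a) ->
    exists2 b, b \in r.2 & forall x : X, m_sat V x b.

Definition si_kripke_complete (L : rule siform -> Prop) : Prop :=
  exists C : kframe -> Prop,
    (forall X, C X -> Relation_Definitions.order X (@acc X)) /\
    (forall r, L r <-> forall X, C X -> si_valid X r).

Definition m_kripke_complete (M : rule mform -> Prop) : Prop :=
  exists C : kframe -> Prop,
    forall r, M r <-> forall X, C X -> m_valid X r.

(* Main.v *)
From HB Require Import structures.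
Require Import Defs.
From mathcomp Require Import all_boot finmap.
From mathcomp Require Import boolp.

(* Both halves compare a frame with its skeleton, which validates a rule exactly
   when the frame validates its Goedel translation. If tau L is complete, so is
   L, via skeletons and the faithfulness of the translation; the latter holds
   because the Boolean algebra generated by the definable upsets of the canonical
   model of L is closed under box. If L is complete and G/D is not in tau L,
   record the sets ("profiles") of boxed subformulae of G/D true at the points of
   the canonical model of tau L by a finite intuitionistic rule with one variable
   per boxed subformula. This rule is not in L, so it fails on a poset Y of the
   given class; pairing each y in Y with the canonical points of the same profile
   yields a preorder with skeleton Y refuting G/D. *)

Set Implicit Arguments.
Unset Strict Implicit.
Unset Printing Implicit Defensive.

Local Open Scope fset_scope.

HB.instance Definition _ := CanIsCountable siform_encK.
HB.instance Definition _ := CanIsCountable mform_encK.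

(** * A Lindenbaum lemma for multiple-conclusion rule systems *)

Section RuleLindenbaum.
Variables (F : countType) (L : rule F -> Prop).

Definition rule_closed (Th : F -> Prop) : Prop :=
  forall q, L q -> (forall a, a \in q.1 -> Th a) -> exists2 b, b \in q.2 & Th b.

Hypothesis weak : forall G G' D D' : {fset F},
  L (G, D) -> L (G `|` G', D `|` D').
Hypothesis refl : forall a : F, L ([fset a], [fset a]).
Hypothesis cut : forall (G D : {fset F}) (a : F),
  L (G, a |` D) -> L (a |` G, D) -> L (G, D).

(** Stage [m.+1] decides the formula with code [m]: it joins the conclusions if the rule stays
    unprovable, and the premises otherwise. Each stage is still a finite rule. *)
Fixpoint saturate (r : rule F) (n : nat) : rule F :=
  if n is m.+1 then
    let q := saturate r m in
    if choice.unpickle m is Some a then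
      if `[< L (q.1, a |` q.2) >] then (a |` q.1, q.2) else (q.1, a |` q.2)
    else q
  else r.

(** By cut, a rule that becomes provable both with [a] among its conclusions and with [a] among its
    premises is provable already. *)
Lemma saturate_unprovable r n : ~ L r -> ~ L (saturate r n).
Proof.
move=> nr; elim: n => //= n IHn; case: (choice.unpickle n) => // a.
case: asboolP => // La Ln; apply: IHn; case: (saturate r n) La Ln => G D /=.
exact: cut.
Qed.

Lemma saturate_mono r m n : m <= n ->
  (saturate r m).1 `<=` (saturate r n).1 /\ (saturate r m).2 `<=` (saturate r n).2.
Proof.
elim: n => [|n IHn]; first by rewrite leqn0 => /eqP ->.
rewrite leq_eqVlt => /predU1P[-> //|/IHn[m1 m2]] /=.
case: (choice.unpickle n) => [a|//]; case: asboolP => _ /=; split=> //;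
  exact: (fsubset_trans _ (fsubsetU1 _ _)).
Qed.

Lemma saturate_cover r a : exists n, a \in (saturate r n).1 `|` (saturate r n).2.
Proof.
exists (choice.pickle a).+1; rewrite /= choice.pickleK; case: asboolP => _ /=;
  by rewrite !inE eqxx ?orbT.
Qed.

(** Compactness: a finite set caught formula by formula is caught by one stage. Taking [P] to be
    either projection covers both premises and conclusions. *)
Lemma saturate_sub r (S : {fset F}) (P : rule F -> {fset F}) :
  (forall m n, m <= n -> P (saturate r m) `<=` P (saturate r n)) ->
  (forall a, a \in S -> exists n, a \in P (saturate r n)) ->
  exists n, S `<=` P (saturate r n).
Proof.
move=> mono; elim/finSet_rect: S => S IHS bnd.
have [->|[a aS]] := fset_0Vmem S; first by exists 0; exact: fsub0set.
have [||m Sm] := IHS (S `\ a); first exact: fproperD1.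
  by move=> b /fsetD1P[_]; exact: bnd.
have [n an] := bnd a aS.
exists (maxn m n); rewrite -(fsetD1K aS) fsubUset fsub1set.
rewrite (fsubset_trans Sm) ?mono ?leq_maxl // andbT.
by move/fsubsetP: (mono n (maxn m n) (leq_maxr _ _)); apply.
Qed.

(** [Th] collects the premises of all stages. A rule of [L] with premises in [Th] and conclusions
    outside it would lie inside a single stage, which weakening would then make provable. *)
Lemma rule_lindenbaum r : ~ L r ->
  exists Th : F -> Prop, [/\ rule_closed Th,
    forall a, a \in r.1 -> Th a & forall b, b \in r.2 -> ~ Th b].
Proof.
(* A formula on both sides would make the stage provable by reflexivity and weakening. *)
move=> nr; have dis n a : a \in (saturate r n).1 -> a \in (saturate r n).2 -> False.
  move=> a1 a2; apply: (saturate_unprovable (n := n) nr).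
  have := weak (saturate r n).1 (saturate r n).2 (refl a).
  rewrite (fsetUidPr _ _ _) ?fsub1set // (fsetUidPr _ _ _) ?fsub1set //.
  by rewrite -surjective_pairing.
exists (fun a => exists n, a \in (saturate r n).1); split.
- move=> [G D] Lq /= GTh; apply: contrapT => noD.
  have [|m Gm] := saturate_sub (P := fst) _ GTh.
    by move=> m n /(saturate_mono r)[].
  have [||n Dn] := @saturate_sub r D snd.
  - by move=> ? ? /(saturate_mono r)[].
  - move=> b bD; have [k] := saturate_cover r b; rewrite inE => /orP[bk|bk].
      by case: noD; exists b => //; exists k.
    by exists k.
  apply: (saturate_unprovable (n := maxn m n) nr).
  have [m1 _] := saturate_mono r (leq_maxl m n).
  have [_ n2] := saturate_mono r (leq_maxr m n).
  have := weak (saturate r (maxn m n)).1 (saturate r (maxn m n)).2 Lq.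
  rewrite (fsetUidPr _ _ (fsubset_trans Gm m1)).
  by rewrite (fsetUidPr _ _ (fsubset_trans Dn n2)) -surjective_pairing.
- by move=> a ar; exists 0.
- move=> b br [n bn]; apply: (dis n b) => //.
  by have [_ /fsubsetP] := saturate_mono r (leq0n n); apply.
Qed.

End RuleLindenbaum.

(** * Relatively maximal theories over an abstract implication *)

Section Theories.
Variables (F : countType) (imp : F -> F -> F).

(** Only the implicational axioms are recorded, so that one extension lemma serves both [SImp] and
    [MImp]. *)
Record theory (S : F -> Prop) : Prop := Theory {
  theory_K : forall a b, S (imp a (imp b a));
  theory_S : forall a b c,
    S (imp (imp a (imp b c)) (imp (imp a b) (imp a c)));
  theory_mp : forall a b, S a -> S (imp a b) -> S b
}.

Lemma theory_weaken S a c : theory S -> S c -> S (imp a c).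
Proof. by move=> tS Sc; exact: (theory_mp tS Sc (theory_K tS c a)). Qed.

Lemma theory_refl S a : theory S -> S (imp a a).
Proof.
move=> tS; apply: (theory_mp tS (theory_K tS a a)).
by apply: (theory_mp tS (theory_K tS a (imp a a))); apply: theory_S.
Qed.

(** This set is the theory obtained by adding [a] to [S]; defining it through implication builds the
    deduction theorem in. *)
Lemma theory_under S a : theory S -> theory (fun c => S (imp a c)).
Proof.
move=> tS; split=> [b c|b c d|b c Sb Sbc].
- exact: theory_weaken (theory_K tS b c).
- exact: theory_weaken (theory_S tS b c d).
- by apply: (theory_mp tS Sb); apply: (theory_mp tS Sbc); apply: theory_S.
Qed.

Fixpoint extension (f : F) (S : F -> Prop) (n : nat) : F -> Prop :=
  if n is m.+1 then
    let Q := extension f S m in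
    if choice.unpickle m is Some a then
      if `[< Q (imp a f) >] then Q else fun c => Q (imp a c)
    else Q
  else S.

Lemma extension_theory f S n : theory S -> theory (extension f S n).
Proof.
move=> tS; elim: n => //= n IHn; case: (choice.unpickle n) => // a.
by case: asboolP => // _; exact: theory_under.
Qed.

Lemma extension_mono f S m n a : theory S -> m <= n ->
  extension f S m a -> extension f S n a.
Proof.
move=> tS + Sa; elim: n => [|n IHn]; first by rewrite leqn0 => /eqP <-.
rewrite leq_eqVlt => /predU1P[<- //|/IHn] /=.
case: (choice.unpickle n) => // b; case: asboolP => // _.
by apply: theory_weaken; exact: extension_theory.
Qed.

Lemma extension_avoids f S n : ~ S f -> ~ extension f S n f.
Proof. by move=> Sf; elim: n => //= n IHn; case: (choice.unpickle n) => // b; case: asboolP. Qed.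

(** The last clause is maximality among theories omitting [f]. It yields primeness in the
    intuitionistic case and negation completeness in the modal one. *)
Lemma theory_extension S f : theory S -> ~ S f ->
  exists T : F -> Prop, [/\ theory T, forall a, S a -> T a, ~ T f &
    forall a, T a \/ T (imp a f)].
Proof.
move=> tS nf; exists (fun a => exists n, extension f S n a).
have tn n := extension_theory f n tS.
split.
- split=> [a b|a b c|a b [m Sm] [n Sn]].
  + by exists 0; exact: theory_K.
  + by exists 0; exact: theory_S.
  + exists (maxn m n); apply: (theory_mp (tn _)).
      exact: extension_mono (leq_maxl m n) Sm.
    exact: extension_mono (leq_maxr m n) Sn.
- by move=> a Sa; exists 0.
- by move=> [n]; exact: extension_avoids.
- move=> a; case: (EM (extension f S (choice.pickle a) (imp a f))) => H.
    by right; exists (choice.pickle a).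
  left; exists (choice.pickle a).+1; rewrite /= choice.pickleK; case: asboolP => // _.
  exact: theory_refl.
Qed.

End Theories.

(** * Modal soundness, over frames with a family of admissible sets *)

Definition preorder_frame (X : kframe) : Prop :=
  (forall x : X, acc x x) /\ (forall x y z : X, acc x y -> acc y z -> acc x z).

Lemma m_sat_subst (X : kframe) (V : valuation X) s a x :
  m_sat V x (m_subst s a) <-> m_sat (fun n y => m_sat V y (s n)) x a.
Proof.
elim: a x => //= [a IH|a IHa b IHb|a IHa b IHb|a IH] x.
- by rewrite IH.
- by rewrite IHa IHb.
- by rewrite IHa IHb.
- by split=> H y /H /IH.
Qed.

Lemma prop_eval_sat (X : kframe) (V : valuation X) x a :
  prop_eval (fun b => `[< m_sat V x b >]) a = `[< m_sat V x a >].
Proof.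
elim: a => //= [||a ->|a -> b ->|a -> b ->].
- by apply/esym/asboolP.
- by apply/esym/asboolP.
- by rewrite asbool_neg.
- by rewrite asbool_and.
- by rewrite asbool_or.
Qed.

Lemma m_sat_imp (X : kframe) (V : valuation X) x a b :
  m_sat V x (MImp a b) <-> (m_sat V x a -> m_sat V x b).
Proof.
split=> /= [[na /na|] //|ab].
by case: (EM (m_sat V x a)) => [/ab|]; [right|left].
Qed.

Lemma normal_logic_sound (Ax : mform -> Prop) (X : kframe) (V : valuation X) a :
  (forall b, Ax b -> forall x : X, m_sat V x b) ->
  normal_logic Ax a -> forall x : X, m_sat V x a.
Proof.
move=> sAx; elim=> {a} [a ta|a b|a Axa|a b _ IHa _ IHab|a _ IHa] x.
- by apply/asboolP; rewrite -prop_eval_sat; exact: ta.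
- rewrite m_sat_imp => ab; rewrite m_sat_imp => sa y xy.
  by have /m_sat_imp := ab y xy; apply; exact: sa.
- exact: sAx.
- by have /m_sat_imp := IHab x; apply.
- by move=> y _; exact: IHa.
Qed.

Lemma S4_sound (X : kframe) (V : valuation X) a :
  preorder_frame X -> S4 a -> forall x : X, m_sat V x a.
Proof.
move=> [Xr Xt]; apply: normal_logic_sound => _ [b|b] x; rewrite m_sat_imp => sb.
- exact: sb (Xr x).
- by move=> y xy z yz; apply: sb; exact: Xt xy yz.
Qed.

(** With such a family the frame becomes a general frame. The canonical frame of [L] will be shown
    to validate translated rules for valuations in one such family. *)
Record admissible (X : kframe) (A : (X -> Prop) -> Prop) : Prop := Admissible {
  adm_bot : A (fun=> False);
  adm_top : A (fun=> True);
  adm_neg : forall P, A P -> A (fun x => ~ P x);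
  adm_and : forall P Q, A P -> A Q -> A (fun x => P x /\ Q x);
  adm_or : forall P Q, A P -> A Q -> A (fun x => P x \/ Q x);
  adm_box : forall P, A P -> A (fun x => forall y, acc x y -> P y)
}.

Definition gen_valid (X : kframe) (A : (X -> Prop) -> Prop) (r : rule mform) : Prop :=
  forall V : valuation X, (forall n, A (V n)) ->
    (forall a, a \in r.1 -> forall x : X, m_sat V x a) ->
    exists2 b, b \in r.2 & forall x : X, m_sat V x b.

Lemma m_valid_gen (X : kframe) r : m_valid X r <-> gen_valid (X := X) (fun=> True) r.
Proof. by split=> H V; [move=> _|]; apply: H. Qed.

Lemma admissible_sat (X : kframe) (A : (X -> Prop) -> Prop) (V : valuation X) a :
  admissible A -> (forall n, A (V n)) -> A (fun x => m_sat V x a).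
Proof. by case=> ? ? ? ? ? ? AV; elim: a => /=; auto. Qed.

(** Admissibility enters through closure under substitution: the substituted formulae must again
    define members of [A]. *)
Lemma gen_valid_normal (X : kframe) (A : (X -> Prop) -> Prop) :
  admissible A -> normal_modal_rule_system (gen_valid A).
Proof.
move=> adA; split.
- split.
  + move=> s [G D] H V AV /= sG.
    have [n|a aG x|b bD sb] := H (fun n x => m_sat V x (s n)).
    * exact: admissible_sat.
    * by rewrite -m_sat_subst; apply: sG; exact: in_imfset.
    * by exists (m_subst s b); [exact: in_imfset | move=> x; rewrite m_sat_subst].
  + by move=> a V _ sa; exists a; [rewrite inE | apply: sa; rewrite inE].
  + move=> G G' D D' H V AV sG; have [//|a aG|b bD sb] := H V.
      by apply: sG; rewrite inE aG.
    by exists b; rewrite // inE bD.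
  + move=> G D a H1 H2 V AV sG; have [//|//|b /=] := H1 V.
    rewrite inE => /orP[|bD sb]; last by exists b.
    rewrite inE => /eqP -> sa; apply: (H2 V AV) => c /=.
    by rewrite !inE => /orP[/eqP ->|/sG].
- move=> a Ka V _ _; exists a; first by rewrite inE.
  by apply: normal_logic_sound Ka.
- move=> a b V _ s; exists b; first by rewrite inE.
  move=> x; have /m_sat_imp : m_sat V x (MImp a b) by apply: s; rewrite !inE eqxx orbT.
  by apply; apply: s; rewrite !inE eqxx.
- move=> a V _ s; exists (MBox a); first by rewrite inE.
  by move=> x y _; apply: s; rewrite inE.
Qed.

Lemma gen_valid_tau (L : rule siform -> Prop) (X : kframe) (A : (X -> Prop) -> Prop) r :
  preorder_frame X -> admissible A ->
  (forall q, L q -> gen_valid A (map_rule godel q)) -> tau L r -> gen_valid A r.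
Proof.
move=> preX adA LA; apply; first exact: gen_valid_normal.
move=> q [Sq|[q' Lq' ->]]; last exact: LA.
apply: Sq; first exact: gen_valid_normal.
move=> _ [a Sa ->] V _ _; exists a; first by rewrite inE.
exact: S4_sound.
Qed.

(** * The Gödel translation along a skeleton map *)

Section Skeleton.
Variables (X Y : kframe) (p : X -> Y).
Hypothesis preX : preorder_frame X.
Hypothesis p_surj : forall y, exists x, p x = y.
Hypothesis p_acc : forall x x' : X, acc x x' <-> acc (p x) (p x').

(** The hypothesis on [U] and [V] is the variable case, where the translation puts a box;
    surjectivity of [p] supplies the successors needed for implication. *)
Lemma godel_sat (V : valuation X) (U : valuation Y) a x :
  (forall n x, U n (p x) <-> forall x', acc x x' -> V n x') ->
  m_sat V x (godel a) <-> si_sat U (p x) a.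
Proof.
move=> UV; elim: a x => //= [n|a IHa b IHb|a IHa b IHb|a IHa b IHb] x.
- by rewrite UV.
- by rewrite IHa IHb.
- by rewrite IHa IHb.
- split=> [H y xy sa|H x' xx'].
    have [x' px'] := p_surj y; rewrite -px' in xy sa *.
    by case: (H x'); rewrite ?p_acc // ?IHa ?IHb.
  case: (EM (si_sat U (p x') a)) => [sa|]; last by rewrite IHa; left.
  by right; rewrite IHb; apply: H => //; rewrite -p_acc.
Qed.

Lemma skeleton_valid r : m_valid X (map_rule godel r) <-> si_valid Y r.
Proof.
split=> [H U perU sG|H V sG].
(* The pullback of a persistent valuation is closed upwards, so boxing it changes nothing. *)
- pose V n x := U n (p x).
  have UV n x : U n (p x) <-> forall x', acc x x' -> V n x'.
    split=> [Un x' /p_acc xx'|]; first exact: perU xx' Un.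
    by apply; case: preX => + _; apply.
  have [_ /imfsetP[a ar ->]|_ /imfsetP[b br ->] sb] := H V.
    by move=> x; apply/(godel_sat _ _ UV)/sG.
  exists b => // y; have [x <-] := p_surj y.
  by rewrite -(godel_sat _ _ UV).
(* Conversely, [U] is the image of the interior of [V], the set of points all of whose successors
   lie in [V]. *)
- pose U n y := forall x, acc y (p x) -> V n x.
  have UV n x : U n (p x) <-> forall x', acc x x' -> V n x'.
    by split=> Un x' /p_acc; exact: Un.
  have perU : persistent U.
    move=> n y y'; have [x <-] := p_surj y; have [x' <-] := p_surj y'.
    move=> /p_acc xx' Un z /p_acc x'z; apply: Un; apply/p_acc.
    by case: preX => _; apply; [exact: xx'|].
  have [a ar y|b br sb] := H U perU.
    have [x <-] := p_surj y.
    by rewrite -(godel_sat _ _ UV); apply: sG; exact: in_imfset.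
  exists (godel b); first exact: in_imfset.
  by move=> x; rewrite (godel_sat _ _ UV).
Qed.

End Skeleton.

(** * The intuitionistic canonical frame and faithfulness of the translation *)

Fixpoint si_conj (s : seq siform) : siform :=
  if s is a :: t then SAnd a (si_conj t) else STop.

Fixpoint si_disj (s : seq siform) : siform :=
  if s is a :: t then SOr a (si_disj t) else SBot.

Lemma rule_system_lindenbaum (F : countType) sub (L : rule F -> Prop) r : rule_system sub L ->
  ~ L r -> exists Th : F -> Prop, [/\ rule_closed L Th,
    forall a, a \in r.1 -> Th a & forall b, b \in r.2 -> ~ Th b].
Proof. by case=> _ ? ? ?; exact: rule_lindenbaum. Qed.

Lemma rule_closed_axiom (F : countType) (L : rule F -> Prop) Th a :
  rule_closed L Th -> L (axiom_rule a) -> Th a.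
Proof.
move=> cTh /cTh[|b] /=; first by move=> b; rewrite inE.
by rewrite inE => /eqP ->.
Qed.

Section SiCanonical.
Variables (L : rule siform -> Prop) (Th : siform -> Prop).
Hypotheses (hL : si_rule_system L) (ThL : rule_closed L Th).

Definition si_prime (P : siform -> Prop) : Prop :=
  [/\ theory SImp P, forall a, Th a -> P a, ~ P SBot &
    forall a b, P (SOr a b) -> P a \/ P b].

(** The frame is empty when [Th] contains [SBot]; unprovable rules without conclusions can lead to
    such a [Th]. *)
Definition si_canon : kframe :=
  @KFrame {P | si_prime P} (fun P Q => forall a, sval P a -> sval Q a).

Lemma IPC_Th a : IPC a -> Th a.
Proof. by move=> /(si_IPC hL); exact: rule_closed_axiom. Qed.

Lemma Th_theory : theory SImp Th.
Proof.
split=> [a b|a b c|a b Ta Tab].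
- exact/IPC_Th/IPC_K.
- exact/IPC_Th/IPC_S.
- have [|c] := ThL (si_mp hL a b); last by rewrite inE => /eqP ->.
  by move=> c; rewrite !inE => /orP[/eqP ->|/eqP ->].
Qed.

(** Relative maximality gives primeness: if [a] and [b] both imply [f], so does their
    disjunction. *)
Lemma si_extend S f : theory SImp S -> (forall a, Th a -> S a) -> ~ S f ->
  exists x : si_canon, (forall a, S a -> sval x a) /\ ~ sval x f.
Proof.
move=> tS ThS /(theory_extension tS)[T [tT ST nT maxT]].
have ThT a : Th a -> T a by move=> /ThS /ST.
suff pT : si_prime T by exists (exist _ T pT).
split=> // [Tbot|a b Tab].
  by apply/nT/(theory_mp tT Tbot)/ThT/IPC_Th/IPC_bot.
case: (maxT a) => [|Ta]; first by left.
case: (maxT b) => [|Tb]; first by right.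
case: nT; apply: (theory_mp tT Tab); apply: (theory_mp tT Tb).
by apply: (theory_mp tT Ta); apply/ThT/IPC_Th/IPC_or.
Qed.

(** Truth at all points thus amounts to membership in [Th], which is how closure of [Th] under [L]
    becomes validity of rules. *)
Lemma si_separate a : (forall x : si_canon, sval x a) -> Th a.
Proof.
move=> H; apply: contrapT => /(si_extend Th_theory)[//|x [_]].
by apply; exact: H.
Qed.

Implicit Type x : si_canon.

Lemma canon_theory x : theory SImp (sval x).
Proof. by case: (svalP x). Qed.

Lemma canon_IPC x a : IPC a -> sval x a.
Proof. by move=> /IPC_Th; case: (svalP x) => _ H _ _; exact: H. Qed.

Lemma canon_top x : sval x STop.
Proof. exact/canon_IPC/IPC_top. Qed.

Lemma canon_bot x : ~ sval x SBot.
Proof. by case: (svalP x). Qed.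

Lemma canon_and x a b : sval x (SAnd a b) <-> sval x a /\ sval x b.
Proof.
have mp := theory_mp (canon_theory x); split=> [xab|[xa xb]].
- by split; apply: (mp _ _ xab); apply: canon_IPC; [exact: IPC_andl|exact: IPC_andr].
- by apply: (mp _ _ xb); apply: (mp _ _ xa); exact/canon_IPC/IPC_and.
Qed.

Lemma canon_or x a b : sval x (SOr a b) <-> sval x a \/ sval x b.
Proof.
have mp := theory_mp (canon_theory x); split=> [|[xa|xb]].
- by case: (svalP x) => _ _ _; apply.
- by apply: (mp _ _ xa); exact/canon_IPC/IPC_orl.
- by apply: (mp _ _ xb); exact/canon_IPC/IPC_orr.
Qed.

Lemma canon_imp x a b :
  sval x (SImp a b) <-> forall y, acc x y -> sval y a -> sval y b.
Proof.
have tx := canon_theory x; split=> [xab y xy ya|H].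
  exact: (theory_mp (canon_theory y) ya (xy _ xab)).
(* The theory generated by [x] and [a] omits [b], so it extends to a point above [x] omitting
   [b]. *)
apply: contrapT => nab; have [c Thc|y [xy nyb]] := si_extend (theory_under a tx) _ nab.
  by apply: theory_weaken => //; case: (svalP x) => _ H' _ _; exact: H'.
apply: nyb; apply: H; last by apply: xy; apply: theory_refl.
by move=> c xc; apply: xy; apply: theory_weaken.
Qed.

Lemma canon_conj x s : sval x (si_conj s) <-> forall a, a \in s -> sval x a.
Proof.
elim: s => [|a s IHs] /=; first by split=> // _; exact: canon_top.
rewrite canon_and IHs; split=> [[xa xs] b|H].
  by rewrite inE => /predU1P[->|/xs].
by split=> [|b bs]; apply: H; rewrite inE ?eqxx ?bs ?orbT.
Qed.

Lemma canon_sat c (U : valuation si_canon) x a :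
  (forall n x, U n x <-> sval x (c n)) ->
  si_sat U x a <-> sval x (si_subst c a).
Proof.
move=> Uc; elim: a x => //= [||a IHa b IHb|a IHa b IHb|a IHa b IHb] x.
- by split=> // /canon_bot.
- by split=> // _; exact: canon_top.
- by rewrite canon_and IHa IHb.
- by rewrite canon_or IHa IHb.
- by rewrite canon_imp; split=> H y xy; [rewrite -IHa -IHb|rewrite IHa IHb]; exact: H.
Qed.

Lemma canon_preorder : preorder_frame si_canon.
Proof. by split=> [x a|x y z xy yz a /xy /yz]. Qed.

(* Conjunctive normal forms over the sets of points containing a given formula;
   [adm] is the Boolean algebra they generate. *)
Definition cnf (P : si_canon -> Prop) : Prop :=
  exists l : seq (siform * siform),
    forall x, P x <-> forall ab, ab \in l -> sval x ab.1 -> sval x ab.2.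

Definition adm (P : si_canon -> Prop) : Prop := cnf P /\ cnf (fun x => ~ P x).

Lemma cnf_ext P Q : (forall x, P x <-> Q x) -> cnf P -> cnf Q.
Proof. by move=> PQ [l Pl]; exists l => x; rewrite -PQ. Qed.

Lemma cnf_and P Q : cnf P -> cnf Q -> cnf (fun x => P x /\ Q x).
Proof.
move=> [l Pl] [m Qm]; exists (l ++ m) => x; rewrite Pl Qm; split.
  by move=> [Hl Hm] ab; rewrite mem_cat => /orP[/Hl|/Hm].
by move=> H; split=> ab abl; apply: H; rewrite mem_cat abl ?orbT.
Qed.

(** Distributivity: at a single point, the disjunction of two clauses is the clause from the
    conjunction of their antecedents to the disjunction of their consequents. *)
Lemma cnf_or P Q : cnf P -> cnf Q -> cnf (fun x => P x \/ Q x).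
Proof.
move=> [l Pl] [m Qm].
exists [seq (SAnd u.1 v.1, SOr u.2 v.2) | u <- l, v <- m] => x; split.
  move=> PQ _ /allpairsP[[u v] [/= ul vm ->]] /canon_and[xu xv]; rewrite /= canon_or.
  case: PQ => [/Pl/(_ u ul xu)|/Qm/(_ v vm xv)]; by [left|right].
move=> H; case: (EM (P x)) => nP; [by left|right; apply/Qm => v vm xv].
apply: contrapT => nv; apply: nP; apply/Pl => u ul xu.
have := H _ (allpairs_f _ ul vm); rewrite /= canon_and canon_or => H'.
by case: H'.
Qed.

Lemma adm_formula a : adm (fun x => sval x a).
Proof.
split.
- exists [:: (STop, a)] => x; split=> [xa ab|H].
    by rewrite inE => /eqP ->.
  by apply: (H (STop, a)); [rewrite inE|exact: canon_top].
- exists [:: (a, SBot)] => x; split=> [xa ab|H xa].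
    by rewrite inE => /eqP -> /xa.
  by apply: (@canon_bot x); apply: (H (a, SBot)); rewrite ?inE.
Qed.

(** Box distributes over the clauses, and a boxed clause is an intuitionistic implication, so the
    result is defined by one formula. *)
Lemma cnf_box P : cnf P ->
  exists c, forall x, (forall y, acc x y -> P y) <-> sval x c.
Proof.
move=> [l Pl]; exists (si_conj [seq SImp ab.1 ab.2 | ab <- l]) => x.
rewrite canon_conj; split=> [H _ /mapP[ab abl ->]|H y xy].
  by rewrite canon_imp => y /H /Pl; apply.
apply/Pl => ab abl; have := H _ (map_f _ abl); rewrite canon_imp; exact.
Qed.

Lemma adm_admissible : admissible adm.
Proof.
have ext P Q : (forall x, P x <-> Q x) -> adm P -> adm Q.
  by move=> PQ [P1 P2]; split; [apply: cnf_ext P1|apply: cnf_ext P2] => x; rewrite PQ.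
split=> [||P [P1 P2]|P Q [P1 P2] [Q1 Q2]|P Q [P1 P2] [Q1 Q2]|P [P1 P2]].
- by apply: ext (adm_formula SBot) => x; split=> // /canon_bot.
- by apply: ext (adm_formula STop) => x; split=> // _; exact: canon_top.
- by split=> //; apply: cnf_ext P1 => x; rewrite notK.
- split; first exact: cnf_and.
  by apply: cnf_ext (cnf_or P2 Q2) => x; rewrite not_andP.
- split; first exact: cnf_or.
  by apply: cnf_ext (cnf_and P2 Q2) => x; rewrite not_orP.
- have [c Pc] := cnf_box P1.
  by apply: ext (adm_formula c) => x; rewrite Pc.
Qed.

Lemma canon_valid q : L q -> gen_valid adm (map_rule godel q).
Proof.
move=> Lq V admV sG.
(* Every boxed variable is definable by a formula, so evaluating the translation under [V] is
   applying the substitution [c]. *)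
have /choice[c Vc] n : exists c, forall x, (forall y, acc x y -> V n y) <-> sval x c.
  by apply: cnf_box; case: (admV n).
pose U n x := sval x (c n).
have satT x a : m_sat V x (godel a) <-> sval x (si_subst c a).
  rewrite -(@canon_sat c U) //.
  apply: (@godel_sat si_canon si_canon id) => [y|//|n y]; first by exists y.
  by rewrite Vc.
have [|_ /imfsetP[b bq ->] Tb] := ThL (rs_subst (si_rs hL) c Lq).
  move=> _ /imfsetP[a aq ->]; apply: si_separate => x.
  by rewrite -satT; apply: sG; exact: in_imfset.
exists (godel b); first exact: in_imfset.
by move=> x; rewrite satT; case: (svalP x) => _ H _ _; exact: H.
Qed.

End SiCanonical.

Lemma tau_faithful (L : rule siform -> Prop) r :
  si_rule_system L -> tau L (map_rule godel r) -> L r.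
Proof.
move=> hL Tr; apply: contrapT => /(rule_system_lindenbaum (si_rs hL))[Th [ThL r1 r2]].
have := gen_valid_tau (canon_preorder Th) (adm_admissible hL ThL)
  (canon_valid hL ThL) Tr.
(* These sets are closed upwards, so the box that the translation puts on variables has no
   effect. *)
pose V n (x : si_canon Th) := sval x (SVar n).
have satT x a : m_sat V x (godel a) <-> sval x a.
  have -> : sval x a <-> si_sat V x a.
    rewrite (canon_sat hL ThL (c := SVar)) //.
    by have -> : si_subst SVar a = a by elim: a => //= [? -> ? ->|? -> ? ->|? -> ? ->].
  apply: (@godel_sat (si_canon Th) (si_canon Th) id) => [y|//|n y]; first by exists y.
  by split=> [yn z|]; [exact|apply].
move=> /(_ V)[n|_ /imfsetP[a ar ->] x|_ /imfsetP[b br ->] sb].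
- exact: (adm_formula hL ThL).
- by rewrite satT; case: (svalP x) => _ H _ _; exact/H/r1.
- by apply: (r2 b br); apply: (si_separate hL ThL) => x; rewrite -satT.
Qed.

(** * The canonical frame of [tau L] *)

Lemma least_normal_normal P : normal_modal_rule_system (least_normal P).
Proof.
split; first split.
- by move=> s q H M nM PM; apply: (rs_subst (nm_rs nM)); exact: H.
- by move=> a M nM _; apply: (rs_refl (nm_rs nM)).
- by move=> G G' D D' H M nM PM; apply: (rs_weak (nm_rs nM)); exact: H.
- by move=> G D a H1 H2 M nM PM; apply: (rs_cut (nm_rs nM) (H1 _ nM PM)); exact: H2.
- by move=> a Ka M nM _; exact: (nm_K nM).
- by move=> a b M nM _; exact: (nm_mp nM).
- by move=> a M nM _; exact: (nm_nec nM).
Qed.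

Lemma tau_S4 L a : S4 a -> tau L (axiom_rule a).
Proof. by move=> Sa M nM PM; apply: PM; left=> M' nM' PM'; apply: PM'; exists a. Qed.

Lemma tau_godel (L : rule siform -> Prop) q : L q -> tau L (map_rule godel q).
Proof. by move=> Lq M nM PM; apply: PM; right; exists q. Qed.

Section ModalCanonical.
Variables (L : rule siform -> Prop) (Th : mform -> Prop).
Hypothesis ThL : rule_closed (tau L) Th.

Let nmL : normal_modal_rule_system (tau L).
Proof. exact: least_normal_normal. Qed.

(** The negation clause gives consistency and completeness at once. *)
Definition mcs (P : mform -> Prop) : Prop :=
  [/\ theory MImp P, forall a, Th a -> P a &
    forall a, P (MNeg a) <-> ~ P a].

Definition m_canon : kframe :=
  @KFrame {P | mcs P} (fun P Q => forall a, sval P (MBox a) -> sval Q a).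

Lemma S4_Th a : S4 a -> Th a.
Proof. by move=> Sa; apply: (rule_closed_axiom ThL); exact: tau_S4. Qed.

Lemma taut_Th a : tautology a -> Th a.
Proof. by move=> ta; apply/S4_Th/NL_taut. Qed.

Lemma mTh_theory : theory MImp Th.
Proof.
split=> [a b|a b c|a b Ta Tab].
- by apply: taut_Th => v /=; case: (prop_eval v a) (prop_eval v b) => -[].
- apply: taut_Th => v /=.
  by case: (prop_eval v a) (prop_eval v b) (prop_eval v c) => -[] [].
- have [|c] := ThL (nm_mp nmL a b); last by rewrite inE => /eqP ->.
  by move=> c; rewrite !inE => /orP[/eqP ->|/eqP ->].
Qed.

Lemma nec_Th a : Th a -> Th (MBox a).
Proof.
move=> Ta; have [|c] := ThL (nm_nec nmL a); last by rewrite inE => /eqP ->.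
by move=> c; rewrite inE => /eqP ->.
Qed.

Lemma m_extend S f : theory MImp S -> (forall a, Th a -> S a) -> ~ S f ->
  exists x : m_canon, (forall a, S a -> sval x a) /\ ~ sval x f.
Proof.
move=> tS ThS /(theory_extension tS)[T [tT ST nT maxT]].
have ThT a : Th a -> T a by move=> /ThS /ST.
suff pT : mcs T by exists (exist _ T pT).
split=> // a; split=> [Tna Ta|nTa].
  apply: nT; apply: (theory_mp tT Ta); apply: (theory_mp tT Tna);
  apply: ThT; apply: taut_Th => v /=.
  by case: (prop_eval v a) (prop_eval v f) => -[].
case: (maxT a) (maxT (MNeg a)) => // Taf [//|Tnaf]; case: nT.
apply: (theory_mp tT Tnaf); apply: (theory_mp tT Taf);
apply: ThT; apply: taut_Th => v /=.
by case: (prop_eval v a) (prop_eval v f) => -[].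
Qed.

Lemma m_separate a : (forall x : m_canon, sval x a) -> Th a.
Proof.
move=> H; apply: contrapT => /(m_extend mTh_theory)[//|x [_]].
by apply; exact: H.
Qed.

Implicit Type x : m_canon.

Lemma mcanon_theory x : theory MImp (sval x).
Proof. by case: (svalP x). Qed.

Lemma mcanon_Th x a : Th a -> sval x a.
Proof. by case: (svalP x) => _ H _; exact: H. Qed.

Lemma mcanon_neg x a : sval x (MNeg a) <-> ~ sval x a.
Proof. by case: (svalP x). Qed.

Lemma mcanon_top x : sval x MTop.
Proof. by apply/mcanon_Th/taut_Th. Qed.

Lemma mcanon_bot x : ~ sval x MBot.
Proof. by rewrite -mcanon_neg; apply/mcanon_Th/taut_Th. Qed.

Lemma mcanon_taut2 x a b c : (forall v, prop_eval v a -> prop_eval v b -> prop_eval v c) ->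
  sval x a -> sval x b -> sval x c.
Proof.
move=> abc xa xb; have tx := mcanon_theory x.
apply: (theory_mp tx xb); apply: (theory_mp tx xa).
apply/mcanon_Th/taut_Th => v /=; have := abc v.
by case: (prop_eval v a) (prop_eval v b) => -[] //= ->.
Qed.

Lemma mcanon_taut1 x a c : (forall v, prop_eval v a -> prop_eval v c) ->
  sval x a -> sval x c.
Proof. by move=> ac xa; apply: (mcanon_taut2 _ xa xa) => v /ac. Qed.

Lemma mcanon_and x a b : sval x (MAnd a b) <-> sval x a /\ sval x b.
Proof.
split=> [xab|[xa xb]]; last by apply: mcanon_taut2 xa xb => v /= -> ->.
by split; apply: mcanon_taut1 xab => v /= /andP[].
Qed.

Lemma mcanon_or x a b : sval x (MOr a b) <-> sval x a \/ sval x b.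
Proof.
split=> [xab|[xa|xb]].
- case: (EM (sval x a)) => [|/mcanon_neg xna]; [by left|right].
  by apply: mcanon_taut2 xab xna => v /= /orP[->|].
- by apply: mcanon_taut1 xa => v /= ->.
- by apply: mcanon_taut1 xb => v /= ->; rewrite orbT.
Qed.

Lemma mcanon_box x a : sval x (MBox a) <-> forall y, acc x y -> sval y a.
Proof.
split=> [xa y|H]; first exact.
apply: contrapT => nxa; have tx := mcanon_theory x.
have boxTh c : Th c -> sval x (MBox c) by move=> /nec_Th /mcanon_Th.
have boxmp b c : sval x (MBox b) -> sval x (MBox (MImp b c)) -> sval x (MBox c).
  move=> xb xbc; apply: (theory_mp tx xb); apply: (theory_mp tx xbc).
  exact/mcanon_Th/S4_Th/NL_K.
(* The formulae boxed in [x] form a theory containing [Th]; a point extending it and omitting [a] is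
   a successor of [x]. *)
have tS : theory MImp (fun c => sval x (MBox c)).
  split=> // [b c|b c d]; apply: boxTh.
    exact: (theory_K mTh_theory).
  exact: (theory_S mTh_theory).
have [y [xy]] := m_extend tS boxTh nxa.
by apply; exact: H.
Qed.

Lemma mcanon_preorder : preorder_frame m_canon.
Proof.
split=> [x a xa|x y z xy yz a xa].
  apply: (theory_mp (mcanon_theory x) xa).
  exact/mcanon_Th/S4_Th/NL_ax/S4_T.
apply: yz; apply: xy; apply: (theory_mp (mcanon_theory x) xa).
exact/mcanon_Th/S4_Th/NL_ax/S4_4.
Qed.

Lemma mcanon_si_sat s (U : valuation m_canon) x a :
  (forall n x, U n x <-> sval x (MBox (s n))) ->
  si_sat U x a <-> sval x (m_subst s (godel a)).
Proof.
move=> Us; elim: a x => //= [||a IHa b IHb|a IHa b IHb|a IHa b IHb] x.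
- by split=> // /mcanon_bot.
- by split=> // _; exact: mcanon_top.
- by rewrite mcanon_and IHa IHb.
- by rewrite mcanon_or IHa IHb.
- rewrite mcanon_box; split=> H y xy.
    rewrite mcanon_or mcanon_neg -IHa -IHb.
    by case: (EM (si_sat U y a)); [right; exact: H|left].
  by have := H y xy; rewrite mcanon_or mcanon_neg IHa IHb => -[].
Qed.

(** The modal canonical frame, read intuitionistically with boxed formulae as atoms, obeys the rules
    of [L]: the translated rule belongs to [tau L], and so does its instance under [s]. *)
Lemma mcanon_si_valid q s : L q ->
  let U := fun n x => sval x (MBox (s n)) in
  (forall a, a \in q.1 -> forall x, si_sat U x a) ->
  exists2 b, b \in q.2 & forall x, si_sat U x b.
Proof.
move=> Lq U sG; have satT x a := @mcanon_si_sat s U x a (fun _ _ => iff_refl _).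
have [|_ /imfsetP[_ /= /imfsetP[b bq ->] ->] Tb] :=
    ThL (rs_subst (nm_rs nmL) s (tau_godel Lq)).
  move=> _ /imfsetP[_ /= /imfsetP[a aq ->] ->]; apply: m_separate => x.
  by rewrite -satT; exact: sG.
by exists b => // x; rewrite satT; exact: mcanon_Th.
Qed.

End ModalCanonical.

(** * Formulae that exclude profiles *)

Lemma si_sat_conj (Z : kframe) (U : valuation Z) z s :
  si_sat U z (si_conj s) <-> forall a, a \in s -> si_sat U z a.
Proof.
elim: s => [|a s IHs] /=; first by [].
rewrite IHs; split=> [[za zs] b|H].
  by rewrite inE => /predU1P[->|/zs].
by split=> [|b bs]; apply: H; rewrite inE ?eqxx ?bs ?orbT.
Qed.

Lemma si_sat_disj (Z : kframe) (U : valuation Z) z s :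
  si_sat U z (si_disj s) <-> exists2 a, a \in s & si_sat U z a.
Proof.
elim: s => [|a s IHs] /=; first by split=> // -[].
rewrite IHs; split=> [[za|[b bs zb]]|[b]].
- by exists a; rewrite ?inE ?eqxx.
- by exists b; rewrite // inE bs orbT.
- by rewrite inE => /predU1P[->|bs zb]; [left|right; exists b].
Qed.

Section Diagrams.
Variables (n : nat).

Definition profile (Z : kframe) (U : valuation Z) (z : Z) : {set 'I_n} :=
  [set i : 'I_n | `[< U i z >]].

(** A point has profile [beta] exactly when it satisfies the antecedent and not the consequent, so
    the implication forbids that profile at all points above. *)
Definition excl1 (beta : {set 'I_n}) : siform :=
  SImp (si_conj [seq SVar (val i) | i <- enum beta])
       (si_disj [seq SVar (val i) | i <- enum (~: beta)]).

Definition excl (W : {set 'I_n} -> Prop) : siform :=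
  si_conj [seq excl1 beta | beta <- enum [set beta | `[< W beta >]]].

Lemma sat_excl1 (Z : kframe) (U : valuation Z) z beta :
  si_sat U z (excl1 beta) <-> forall z', acc z z' -> profile U z' <> beta.
Proof.
split=> [H z' zz' pz'|H z' zz' /si_sat_conj zb].
  have cz : si_sat U z' (si_conj [seq SVar (val i) | i <- enum beta]).
    apply/si_sat_conj => _ /mapP[i + ->]; rewrite mem_enum -pz' inE => /asboolP; exact.
  have /si_sat_disj[_ /mapP[i + ->]] := H z' zz' cz.
  by rewrite mem_enum -pz' !inE => /asboolPn.
apply/si_sat_disj; apply: contrapT => none; apply: (H z' zz').
apply/setP => i; rewrite inE; case: (boolP (i \in beta)) => ib.
  by apply/asboolP; apply: (zb (SVar i)); apply: map_f; rewrite mem_enum.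
apply/asboolPn => Ui; apply: none; exists (SVar i) => //.
by apply: map_f; rewrite mem_enum inE.
Qed.

Lemma sat_excl (Z : kframe) (U : valuation Z) z W :
  si_sat U z (excl W) <-> forall z', acc z z' -> ~ W (profile U z').
Proof.
rewrite si_sat_conj; split=> [H z' zz' Wz'|H _ /mapP[beta + ->]].
  have /sat_excl1 /(_ z' zz') : si_sat U z (excl1 (profile U z')); last exact.
  by apply: H; apply: map_f; rewrite mem_enum inE; apply/asboolP.
rewrite mem_enum inE => /asboolP Wb; apply/sat_excl1 => z' zz' e.
by apply: (H z' zz'); rewrite e.
Qed.

End Diagrams.

(** * The diagram rule and the unravelled countermodel *)

Fixpoint box_bodies (a : mform) : seq mform :=
  match a with
  | MVar _ | MBot | MTop => [::]
  | MNeg a => box_bodies a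
  | MAnd a b | MOr a b => box_bodies a ++ box_bodies b
  | MBox a => a :: box_bodies a
  end.

Section Unravel.
Variables (L : rule siform -> Prop) (Th : mform -> Prop) (r : rule mform).
Hypotheses (ThL : rule_closed (tau L) Th).
Hypotheses (Thr1 : forall a, a \in r.1 -> Th a) (Thr2 : forall b, b \in r.2 -> ~ Th b).

Let bodies : seq mform := flatten [seq box_bodies a | a <- enum_fset r.1 ++ enum_fset r.2].
Let n := size bodies.
Let body (i : nat) : mform := nth MTop bodies i.
Let X : kframe := m_canon Th.
Let UX : valuation X := fun i x => sval x (MBox (body i)).
Let prof (x : X) : {set 'I_n} := profile n UX x.

Definition refuting (a : mform) (beta : {set 'I_n}) : Prop :=
  exists2 x : X, prof x = beta & ~ sval x a.

(** The first premise admits only profiles of canonical points. The others force variable [i]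
    wherever no profile above belongs to a canonical point refuting body [i]. A failing conclusion
    exhibits a profile shared with a canonical point refuting [b]. *)
Definition diagram_rule : rule siform :=
  ([fset a in excl (fun beta => ~ exists x : X, prof x = beta) ::
      [seq SImp (excl (refuting (body i))) (SVar i) | i <- iota 0 n]],
   [fset excl (refuting b) | b in r.2]).

(** With [SVar i] read as the box of body [i], the canonical frame satisfies every premise, while a
    conclusion true throughout would put some [b] of [r.2] into [Th]. *)
Lemma diagram_unprovable : ~ L diagram_rule.
Proof.
have [Xr Xt] := mcanon_preorder ThL.
move=> /(mcanon_si_valid ThL (s := body))[a|_ /imfsetP[b br ->] H].
  rewrite inE /= inE => /predU1P[->|/mapP[i _ ->]] x.
    by apply/sat_excl => z _; apply; exists z.
  move=> y xy /sat_excl H; apply/(mcanon_box ThL) => z yz.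
  by apply: contrapT => nz; apply: (H z yz); exists z.
apply: (Thr2 br); apply: (m_separate ThL) => x.
by apply: contrapT => nx; have /sat_excl /(_ x (Xr x)) := H x; apply; exists x.
Qed.

Section Refuted.
Variables (Y : kframe) (U : valuation Y).
Hypotheses (preY : preorder_frame Y) (perU : persistent U).
Hypothesis sat1 : forall a, a \in diagram_rule.1 -> forall y, si_sat U y a.
Hypothesis sat2 : forall b, b \in diagram_rule.2 -> ~ forall y, si_sat U y b.

(** Accessibility looks only at the first component, so the first projection is a skeleton map onto
    [Y], while the canonical component decides the truth of formulae. *)
Definition unravel : kframe :=
  @KFrame {yx : Y * X | prof yx.2 = profile n U yx.1}
    (fun u v => acc (sval u).1 (sval v).1).

Lemma unravel_preorder : preorder_frame unravel.
Proof. by case: preY => Yr Yt; split=> [u|u v w]; [exact: Yr|exact: Yt]. Qed.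

Lemma profile_realized y : exists x, prof x = profile n U y.
Proof.
have /sat_excl H : si_sat U y (excl (fun beta => ~ exists x : X, prof x = beta)).
  by apply: sat1; rewrite inE /= inE eqxx.
by apply: contrapT; apply: H; case: preY.
Qed.

Lemma unravel_surj y : exists u : unravel, (sval u).1 = y.
Proof. by have [x xy] := profile_realized y; exists (exist _ (y, x) xy). Qed.

(** The box case rests on equality of profiles: a box of an indexed body holds at the canonical
    component exactly when its variable holds at the component in [Y]. *)
Lemma unravel_truth (u : unravel) a : {subset box_bodies a <= bodies} ->
  m_sat (fun k (v : unravel) => sval (sval v).2 (MVar k)) u a <-> sval (sval u).2 a.
Proof.
elim: a u => //= [||a IH|a IHa b IHb|a IHa b IHb|a IH] u sub.
- by split=> // /(mcanon_bot ThL).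
- by split=> // _; exact: (mcanon_top ThL).
- by rewrite mcanon_neg IH.
- by rewrite (mcanon_and ThL) IHa ?IHb // => c cab; apply: sub; rewrite mem_cat cab ?orbT.
- by rewrite (mcanon_or ThL) IHa ?IHb // => c cab; apply: sub; rewrite mem_cat cab ?orbT.
have {}IH v := IH v (fun c cb => sub c (mem_behead (s := a :: _) cb)).
have aB : a \in bodies by apply: sub; rewrite inE eqxx.
have ltn : index a bodies < n by rewrite index_mem.
pose i := Ordinal ltn; have bi : body i = a by rewrite /body nth_index.
have box_U (v : unravel) : sval (sval v).2 (MBox a) <-> U i (sval v).1.
  have /setP /(_ i) := svalP v; rewrite !inE /UX bi => e.
  by split=> /asboolP; [rewrite e|rewrite -e] => /asboolP.
(* From right to left, persistence carries the variable to [v], and reflexivity of the canonical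
   frame removes the box there. *)
split=> [H|/box_U Ui v uv]; last first.
  have [Xr _] := mcanon_preorder ThL.
  by rewrite IH; apply: Xr; apply/box_U; exact: perU uv Ui.
apply: contrapT; rewrite box_U => nU; apply: nU.
have [Yr Yt] := preY.
(* By this premise it suffices to exclude, above [u], all profiles of canonical points refuting the
   body; such a point paired with [y] would be a successor of [u] contradicting [H]. *)
have : si_sat U (sval u).1 (SImp (excl (refuting (body i))) (SVar i)).
  apply: sat1; rewrite inE /= inE; apply/orP; right.
  by apply/mapP; exists (val i); rewrite // mem_iota.
apply; first exact: Yr.
apply/sat_excl => y uy [x xy]; rewrite bi => nx; apply: nx.
have := H (exist _ (y, x) xy) uy; by rewrite IH.
Qed.

Lemma unravel_refutes : ~ m_valid unravel r.
Proof.
have sub a : a \in enum_fset r.1 ++ enum_fset r.2 -> {subset box_bodies a <= bodies}.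
  by move=> ar c ca; apply/flattenP; exists (box_bodies a) => //; exact: map_f.
move=> /(_ (fun k (v : unravel) => sval (sval v).2 (MVar k)))[a ar u|b br H].
  rewrite unravel_truth; first exact/mcanon_Th/Thr1.
  by apply: sub; rewrite mem_cat ar.
apply: (sat2 (b := excl (refuting b))); first exact: in_imfset.
move=> y; apply/sat_excl => y' yy' [x xy]; apply.
have := H (exist _ (y', x) xy); rewrite unravel_truth //.
by apply: sub; rewrite mem_cat br orbT.
Qed.

End Refuted.
End Unravel.

(** * Transfer of Kripke completeness in both directions *)

Lemma m_valid_tau L (X : kframe) r : preorder_frame X ->
  (forall q, L q -> m_valid X (map_rule godel q)) -> tau L r -> m_valid X r.
Proof.
move=> preX LX Tr; apply/m_valid_gen; apply: gen_valid_tau Tr => //.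
by move=> q /LX /m_valid_gen.
Qed.

Lemma complete_tau L : si_rule_system L ->
  si_kripke_complete L -> m_kripke_complete (tau L).
Proof.
move=> hL [C [ordC LC]].
(* This is the largest class of preorders validating [tau L], so only the refutation of unprovable
   rules requires a construction. *)
exists (fun X => preorder_frame X /\ forall q, L q -> m_valid X (map_rule godel q)) => r.
split=> [Tr X [preX LX]|H]; first exact: m_valid_tau Tr.
apply: contrapT => /(rule_system_lindenbaum (nm_rs (least_normal_normal _)))[Th [ThL Th1 Th2]].
apply: (diagram_unprovable ThL Th2); apply/LC => Y CY U perU sat1.
have preY : preorder_frame Y by have [? ? _] := ordC Y CY.
apply: contrapT => nex.
apply: (unravel_refutes ThL Th1 preY perU sat1).
  by move=> b bD sb; apply: nex; exists b.
(* The unravelled frame lies in the class because its skeleton [Y] validates [L]. *)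
apply: H; split=> [|q Lq]; first exact: unravel_preorder.
apply/(skeleton_valid (p := fun u : unravel _ _ _ => (sval u).1)).
- exact: unravel_preorder.
- exact: unravel_surj.
- by [].
- by move/LC: Lq; apply.
Qed.

(** Correspondence theory: each axiom is tested at [x] with the variable true exactly at the
    successors of [x]. *)
Lemma frame_preorder (X : kframe) :
  (forall a, S4 a -> m_valid X (axiom_rule a)) -> preorder_frame X.
Proof.
move=> S4X; have S4s a (V : valuation X) x : S4 a -> m_sat V x a.
  move=> /S4X /(_ V)[b|b]; first by rewrite inE.
  by rewrite inE => /eqP ->.
split=> [x|x y z xy yz].
- have := S4s _ (fun _ => acc x) x (NL_ax (S4_T (MVar 0))).
  by rewrite m_sat_imp; apply.
- have := S4s _ (fun _ => acc x) x (NL_ax (S4_4 (MVar 0))).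
  by rewrite m_sat_imp => H; exact: (H (fun _ xw => xw) y xy z yz).
Qed.

(* Points of the skeleton are the principal upsets, which makes antisymmetry
   an instance of extensionality. *)
Definition skeleton (X : kframe) : kframe :=
  @KFrame {P : X -> Prop | exists x, P = acc x}
    (fun P Q => forall y, sval Q y -> sval P y).

Lemma skeleton_order X : Relation_Definitions.order _ (@acc (skeleton X)).
Proof.
split=> [P y|P Q R PQ QR y /QR /PQ|[P hP] [Q hQ] PQ QP] //.
by apply: eq_exist; rewrite predeqE => y; split=> [/QP|/PQ].
Qed.

Definition skeleton_proj (X : kframe) (x : X) : skeleton X :=
  exist _ (acc x) (ex_intro _ x erefl).

Lemma complete_of_tau L : si_rule_system L ->
  m_kripke_complete (tau L) -> si_kripke_complete L.
Proof.
move=> hL [C TC]; exists (fun Y => exists2 X, C X & Y = skeleton X).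
split=> [_ [X _ ->]|r]; first exact: skeleton_order.
have LT : L r <-> tau L (map_rule godel r).
  by split; [exact: tau_godel|exact: tau_faithful].
have val X : C X -> m_valid X (map_rule godel r) <-> si_valid (skeleton X) r.
  move=> CX; have preX : preorder_frame X.
    by apply: frame_preorder => a /(tau_S4 (L := L)) /TC; apply.
  apply: (skeleton_valid (p := @skeleton_proj X)) => //.
    (* Points with the same upset are equal whatever their existence proofs, by proof
       irrelevance. *)
    by move=> [P hP]; have [x Px] := hP; exists x; apply: eq_exist.
  have [Xr Xt] := preX.
  by move=> x x'; split=> [xx' y /= |]; [exact: Xt|apply; exact: Xr].
rewrite LT TC; split=> [H _ [X CX ->]|H X CX]; first by rewrite -val //; exact: H.
by rewrite val //; apply: H; exists X.
Qed.

Theorem theorem3p47 (L : rule siform -> Prop) (hL : si_rule_system L) :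
  si_kripke_complete L <-> m_kripke_complete (tau L).
Proof. by split; [exact: complete_tau|exact: complete_of_tau]. Qed.
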